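(* Let $m\ge 6$, $X=\mathbb{F}_{2^m}\setminus\{0,1\}$, and let $W_2,W_6$ be as in the context. Then the triple $(X,W_2,W_6)$ is a $\mathrm{GDD}(2^m-2,2,6)$ with balance parameter $\lambda_6=\frac{(2^m-8)(2^m-16)(2^m-32)}{4!}$.
   Context: $\mathbb{F}_{2^m}$ is the finite field with $2^m$ elements, with zero $0$ and unity $1$; all sums are in $\mathbb{F}_{2^m}$. For each integer $k\ge 2$, $W_k=\{B\subset X : |B|=k,\ \sum_{i\in B} i=1,\ \text{and } \binom{B}{\ell}\cap W_\ell=\emptyset \text{ for all } 2\le \ell\le k-3\}$ (recursive definition; $\binom{B}{\ell}$ is the set of $\ell$-subsets of $B$). A group divisible design $\mathrm{GDD}(v,n,k)$ is a triple $(X,\mathcal{G},\mathcal{B})$ where $X$ is a $v$-set, $\mathcal{G}$ is a collection of $n$-subsets of $X$ (groups) and $\mathcal{B}$ is a collection of $k$-subsets of $X$ (blocks), such that (i) $\mathcal{G}$ is a partition of $X$; (ii) no two elements of a block lie together in a common group; (iii) every pair of distinct elements of $X$ from different groups occurs together in exactly $\lambda$ blocks; $\lambda$ is called the balance parameter. *)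

(* Defs.v *)
From HB Require Import structures.
From mathcomp Require Export all_boot all_order all_algebra all_field.

Set Implicit Arguments.
Unset Strict Implicit.
Unset Printing Implicit Defensive.

Import GRing.Theory.

Definition ksubsets (T : finType) (l : nat) (B : {set T}) : {set {set T}} :=
  [set C : {set T} | C \subset B & #|C| == l].

Section GroupDivisibleDesign.

Variable T : finType.

Record is_GDD (v n k lambda : nat) (X : {set T})
    (groups blocks : {set {set T}}) : Prop := IsGDD {
  GDD_points : #|X| = v;
  GDD_group_card : forall G, G \in groups -> #|G| = n;
  GDD_block_sub : forall B, B \in blocks -> B \subset X;
  GDD_block_card : forall B, B \in blocks -> #|B| = k;
  GDD_partition : partition groups X;
  GDD_transverse : forall B G x y, B \in blocks -> G \in groups ->
    x \in B -> y \in B -> x != y -> ~ (x \in G /\ y \in G);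
  GDD_balance : forall x y, x \in X -> y \in X -> x != y ->
    (forall G, G \in groups -> ~ (x \in G /\ y \in G)) ->
    #|[set B in blocks | (x \in B) && (y \in B)]| = lambda
}.

End GroupDivisibleDesign.

Section Blocks.

Variable F : finFieldType.
Local Open Scope ring_scope.

Definition points : {set F} := [set x : F | (x != 0) && (x != 1)].

(* [Wstep W' k] is the right-hand side of the defining equation of W_k, with
   W' l in place of W_l for 2 <= l <= k - 3; the truncation of the natural
   subtraction is harmless, since for k <= 4 the range of l is empty anyway. *)
Definition Wstep (W' : nat -> {set {set F}}) (k : nat) : {set {set F}} :=
  [set B : {set F} |
    [&& B \subset points, #|B| == k, \sum_(i in B) i == 1 &
        [forall l : 'I_k, ((2 <= l) && (l <= k - 3))%N ==>
           (ksubsets l B :&: W' l == set0)]]].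

(* The first argument bounds the recursion depth. *)
Fixpoint Wrec (d k : nat) : {set {set F}} :=
  if d is d'.+1 then Wstep (Wrec d') k else set0.

(* Meaningful for k >= 2; [WE] is the recursive definition. *)
Definition W (k : nat) : {set {set F}} := Wrec k.+1 k.

Lemma eq_Wstep W1 W2 k :
  (forall l, (l < k)%N -> W1 l = W2 l) -> Wstep W1 k = Wstep W2 k.
Proof.
move=> eW; apply/setP=> B; rewrite !inE; do 3!congr (_ && _).
by apply: eq_forallb => l; rewrite eW.
Qed.

Lemma Wrec_depth d1 d2 k : (k < d1)%N -> (k < d2)%N -> Wrec d1 k = Wrec d2 k.
Proof.
elim: d1 d2 k => [|d1 IH] [|d2] k //= lt1 lt2.
by apply: eq_Wstep => l ltlk; apply: IH; apply: leq_trans ltlk _.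
Qed.

Lemma WE k : W k = Wstep W k.
Proof. by apply: eq_Wstep => l ltlk; apply: Wrec_depth. Qed.

Lemma in_W k (B : {set F}) :
  B \in W k <->
  [/\ B \subset points, #|B| = k, \sum_(i in B) i = 1 &
      forall l, (2 <= l)%N -> (l + 3 <= k)%N -> ksubsets l B :&: W l = set0].
Proof.
rewrite WE inE; split.
  case/and4P=> sBX /eqP cB /eqP sB /forallP H; split=> // l l2 lk.
  have ltlk : (l < k)%N by apply: leq_trans lk; rewrite -addn1 leq_add2l.
  have lk3 : (l <= k - 3)%N by rewrite -(addnK 3 l) leq_sub2r.
  by have := H (Ordinal ltlk); rewrite /= l2 lk3 => /eqP.
case=> sBX cB sB H; apply/and4P; split=> //; try exact/eqP.
apply/forallP=> l; apply/implyP=> /andP[l2 lk]; apply/eqP/H => //.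
have lt3k : (3 < k)%N by rewrite -subn_gt0 (leq_trans _ lk) // ltnW.
by rewrite addnC -leq_subRL // ltnW.
Qed.

End Blocks.

(* Main.v *)
Require Import Defs.
From mathcomp Require Import all_boot all_order all_algebra all_field.
From mathcomp Require Import zify.

(**
  Work in the binary matroid of an elementary abelian 2-group of order q, in
  which a set of points is independent when no nonempty subset sums to 0 and a
  circuit is a minimal dependent set.  Complementation inside a set of sum 1
  shows that B is in W_6 exactly when 1 is not in B and B together with 1 is a
  circuit of size 7.  An independent set A spans 2^|A| points, so counting the
  pairs (z, C) where C is a circuit of size n containing A and z is in C but
  not in A gives, by induction on n - |A|, that A lies in
  \prod_(|A| <= j < n - 1) (q - 2^j) / (n - |A|)! circuits of size n.  The
  balance parameter is the case n = 7 and A = {1, x, y}.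
*)

Set Implicit Arguments.
Unset Strict Implicit.
Unset Printing Implicit Defensive.

Import GRing.Theory.

(** * Independence, spans and circuits over the field with two elements *)

Section BinaryMatroid.

Variable V : finZmodType.
Local Open Scope ring_scope.
Implicit Types (A C S U : {set V}) (z : V).

Definition sumset S : V := \sum_(i in S) i.

Definition independent A : bool :=
  [forall S : {set V}, (S \subset A) && (sumset S == 0) ==> (S == set0)].

(** The empty set passes this test; this is harmless, since the counts evaluated below concern sizes
    at least 3. *)
Definition circuit C : bool :=
  (sumset C == 0) && [forall S : {set V}, (S \proper C) ==> independent S].

(** When [z + z = 0] throughout, all coefficients are 0 or 1, so the subset sums form the whole
    subgroup generated by [A]. *)
Definition span2 A : {set V} := [set sumset S | S in powerset A].

Definition circuits_over (n : nat) A : {set {set V}} :=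
  [set C | [&& circuit C, #|C| == n & A \subset C]].

Lemma independentP A :
  reflect (forall S, S \subset A -> sumset S = 0 -> S = set0) (independent A).
Proof.
apply: (iffP forallP) => H S.
  by move=> sSA /eqP s0; apply/eqP; move: (H S); rewrite sSA s0.
by apply/implyP=> /andP[sSA /eqP s0]; rewrite (H S).
Qed.

Lemma circuitP C :
  reflect (sumset C = 0 /\ forall S, S \proper C -> sumset S = 0 -> S = set0)
          (circuit C).
Proof.
apply: (iffP andP) => [[/eqP sC /forallP H]|[sC H]]; split=> //.
- move=> S pS; move/implyP: (H S) => /(_ pS) /independentP; exact.
- exact/eqP.
apply/forallP=> S; apply/implyP=> pS; apply/independentP=> U sUS.
exact/H/(sub_proper_trans sUS).
Qed.

Lemma circuit_independent C A : circuit C -> A \proper C -> independent A.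
Proof.
move/circuitP=> [_ H] pA; apply/independentP=> S sS.
exact/H/(sub_proper_trans sS).
Qed.

Lemma sumset0 : sumset set0 = 0.
Proof. by rewrite /sumset big_set0. Qed.

Lemma sumset1 z : sumset [set z] = z.
Proof. by rewrite /sumset big_set1. Qed.

Lemma sumsetU1 z S : z \notin S -> sumset (z |: S) = z + sumset S.
Proof. by move=> zS; rewrite /sumset big_setU1. Qed.

Lemma sumsetD1 z S : z \in S -> sumset S = z + sumset (S :\ z).
Proof. by move=> zS; rewrite /sumset (big_setD1 z). Qed.

Lemma sumset_setID S U : sumset S = sumset (S :&: U) + sumset (S :\: U).
Proof. by rewrite /sumset (big_setID U). Qed.

Lemma sumset_setD S U : U \subset S -> sumset S = sumset U + sumset (S :\: U).
Proof. by move=> /setIidPr {1}<-; apply: sumset_setID. Qed.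

Lemma independent0 : independent set0.
Proof. by apply/independentP=> S; rewrite subset0 => /eqP. Qed.

Hypothesis addVV : forall z : V, z + z = 0.

Lemma addVV_eq0 (a b : V) : a + b = 0 -> a = b.
Proof. by move=> ab; rewrite -[a]addr0 -(addVV b) addrA ab add0r. Qed.

(** If two subsets have equal sums, their symmetric difference has sum 0 and lies in [A], hence is
    empty. *)
Lemma sumset_inj A :
  independent A -> {in powerset A &, injective sumset}.
Proof.
move=> /independentP iA S U; rewrite !powersetE => sS sU eSU.
have disj : [disjoint S :\: U & U :\: S].
  by apply/pred0P=> x /=; rewrite !inE; case: (x \in S); rewrite ?andbF.
have s0 : sumset ((S :\: U) :|: (U :\: S)) = 0.
  rewrite /sumset (eq_bigl _ _ (fun x => in_setU x _ _)) bigU //.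
  rewrite -/(sumset (S :\: U)) -/(sumset (U :\: S)).
  move: eSU; rewrite (sumset_setID S U) (sumset_setID U S) setIC.
  by move/addrI=> ->; apply: addVV.
have := iA _ _ s0; rewrite subUset !(subset_trans (subsetDl _ _)) //.
move=> /(_ isT) /setP e0; apply/setP=> x; move: (e0 x); rewrite !inE.
by case: (x \in S); case: (x \in U).
Qed.

Lemma card_span2 A : independent A -> #|span2 A| = (2 ^ #|A|)%N.
Proof.
by move=> iA; rewrite card_in_imset ?card_powerset //; apply: sumset_inj.
Qed.

Lemma sub_span2 A : A \subset span2 A.
Proof.
apply/subsetP=> z zA; apply/imsetP; exists [set z]; last by rewrite sumset1.
by rewrite powersetE sub1set.
Qed.

(** A zero-sum subset through [z] is the same thing as an expression of [z] as a subset sum of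
    [A]. *)
Lemma independentU1 z A : z \notin A ->
  independent (z |: A) = independent A && (z \notin span2 A).
Proof.
move=> zA; apply/independentP/andP => [iz|[/independentP iA zsp] S sS s0].
  split.
    by apply/independentP=> S sS; apply: iz; apply/(subset_trans sS)/subsetUr.
  apply/imsetP=> -[S]; rewrite powersetE => sS zE.
  have zS : z \notin S by apply: contra zA; apply: (subsetP sS).
  have := iz (z |: S) (setUS _ sS); rewrite sumsetU1 // -zE addVV.
  by move=> /(_ erefl) /setP /(_ z); rewrite !inE eqxx.
have sDA : S :\ z \subset A by rewrite subDset.
have [zS|zS] := boolP (z \in S); last first.
  have zS' : [disjoint S & [set z]] by rewrite disjoint_sym disjoints1.
  by apply: iA => //; rewrite -(setDidPl zS').
case/imsetP: zsp; exists (S :\ z); first by rewrite powersetE.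
by apply: addVV_eq0; rewrite -sumsetD1.
Qed.

Lemma span2_set0 : span2 set0 = [set 0].
Proof. by rewrite /span2 powerset0 imset_set1 sumset0. Qed.

Lemma span2_setU1 z A w :
  w \in span2 (z |: A) -> (w \in span2 A) || (z + w \in span2 A).
Proof.
case/imsetP=> S; rewrite powersetE => sS ->.
have [zS|zS] := boolP (z \in S); apply/orP; [right|left]; apply/imsetP.
  exists (S :\ z); first by rewrite powersetE subDset.
  by rewrite (sumsetD1 zS) addrA addVV add0r.
exists S => //; rewrite powersetE; apply/subsetP=> x xS.
move/subsetP/(_ x xS): sS; rewrite !inE => /predU1P[xz|//].
by rewrite -xz xS in zS.
Qed.

(** * Counting the circuits through an independent set *)

Lemma circuits_over_setU1 n z A :
  circuits_over n (z |: A) = [set C in circuits_over n A | z \in C].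
Proof.
apply/setP=> C; rewrite !inE subUset sub1set -!andbA.
by rewrite [(z \in C) && _]andbC.
Qed.

(** Double counting of the pairs [(z, C)] with [z] in [C :\: A]: each [C] has [n - #|A|] choices of
    [z]. *)
Lemma sum_card_circuits_over n A :
  (\sum_(z in ~: A) #|circuits_over n (z |: A)| =
   #|circuits_over n A| * (n - #|A|))%N.
Proof.
transitivity (\sum_(z in ~: A) \sum_(C in circuits_over n A | z \in C) 1)%N.
  apply: eq_bigr => z _; rewrite circuits_over_setU1 -sum1_card.
  by apply: eq_bigl => C; rewrite !inE.
rewrite (exchange_big_dep (mem (circuits_over n A))) /=; last first.
  by move=> z C _ /andP[].
rewrite -sum_nat_const; apply: eq_bigr => C CA.
rewrite inE in CA; have /and3P[_ /eqP cC sAC] := CA.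
have -> : (n - #|A| = #|C :\: A|)%N by rewrite cardsD (setIidPr sAC) cC.
rewrite -[RHS]sum1_card.
by apply: eq_bigl => z; rewrite !inE CA.
Qed.

(** The one missing point is forced by the zero sum. *)
Lemma circuits_over_corank1 A : independent A -> (1 < #|A|)%N ->
  circuits_over #|A|.+1 A = [set sumset A |: A].
Proof.
move=> iA cA; have /independentP iA' := iA.
(* Otherwise the other points of [A], of which there is at least one, would sum to 0. *)
have sA : sumset A \notin A.
  apply/negP=> aA; have := sumsetD1 aA; rewrite -{1}[sumset A]addr0 => /addrI.
  move/esym => s0; have := iA' _ (subsetDl _ _) s0.
  move=> D0; move: cA; rewrite (cardsD1 (sumset A)) aA D0 cards0 //.
apply/setP=> C; rewrite !inE; apply/and3P/eqP => [[cC /eqP nC sAC]|->].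
  have /cards1P[z zE] : #|C :\: A| == 1%N.
    by rewrite cardsD (setIidPr sAC) nC subSnn.
  have zs : z = sumset A.
    move/circuitP: cC => [+ _]; rewrite (sumset_setD sAC) zE sumset1.
    by move/addVV_eq0.
  by rewrite -zs -zE setUC -{1}(setIidPr sAC) setID.
split; last exact: subsetUr; last by rewrite cardsU1 sA.
apply/circuitP; split; first by rewrite sumsetU1 // addVV.
move=> S pS s0; have [aS|aS] := boolP (sumset A \in S); last first.
  apply: iA' => //; apply/subsetP=> x xS.
  move/proper_sub/subsetP/(_ x xS): pS; rewrite !inE => /orP[/eqP xE|//].
  by rewrite -xE xS in aS.
(* [S] without [sumset A] has the same sum as [A], so it equals [A] by injectivity, and [S] is not
   proper. *)
have sDA : S :\ sumset A \subset A by rewrite subDset proper_sub.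
have eq1 : sumset A = sumset (S :\ sumset A).
  by apply: addVV_eq0; rewrite -sumsetD1.
have := sumset_inj iA _ _ eq1; rewrite !powersetE subxx sDA => /(_ isT isT) AE.
have SE : sumset A |: A = S by rewrite {2}AE setD1K.
by move: pS; rewrite SE properxx.
Qed.

Lemma card_circuits_over n A : independent A -> (1 < #|A| < n)%N ->
  (#|circuits_over n A| * (n - #|A|)`! =
   \prod_(#|A| <= j < n.-1) (#|V| - 2 ^ j))%N.
Proof.
move=> iA /andP[cA ltAn]; move dE: (n - #|A|)%N => d.
elim: d A iA cA ltAn dE => [|d IH] A iA cA ltAn dE; first lia.
case: d IH dE => [_|d IH] dE.
  have -> : n = #|A|.+1 by lia.
  by rewrite circuits_over_corank1 // cards1 big_geq.
rewrite factS mulnA -dE -sum_card_circuits_over big_distrl /=.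
(* Points of the span contribute nothing: [z |: A] is dependent, yet it would be a proper subset of
   a circuit, as at least two points are missing. *)
rewrite (bigID (mem (span2 A))) /= big1 ?add0n; last first.
  move=> z /andP[]; rewrite inE => zA zsp.
  suff -> : circuits_over n (z |: A) = set0 by rewrite cards0.
  apply/setP=> C; rewrite !inE; apply/and3P=> -[cC /eqP nC sC].
  have : z |: A \proper C.
    by rewrite properEcard sC nC cardsU1 zA; lia.
  by move/(circuit_independent cC); rewrite independentU1 // zsp andbF.
(* The factor [j = #|A|] counts the points outside the span; for each of them the induction
   hypothesis gives the remaining product. *)
rewrite big_ltn; last by rewrite ltn_predRL -subn_gt0 subnS dE.
rewrite (eq_bigr (fun=> \prod_(#|A|.+1 <= j < n.-1) (#|V| - 2 ^ j))%N).
  rewrite sum_nat_const; congr (_ * _)%N.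
  rewrite -card_span2 // -(cardsC (span2 A)) addKn.
  apply: eq_card => z; rewrite unfold_in !inE andb_idl //.
  by apply: contra; apply/subsetP/sub_span2.
move=> z /andP[]; rewrite inE => zA zsp.
have cz : #|z |: A| = #|A|.+1 by rewrite cardsU1 zA.
rewrite -cz -IH ?cz //; try lia.
by rewrite independentU1 // iA.
Qed.

End BinaryMatroid.

(** * Groups and blocks in a field of characteristic 2 *)

Section Design.

Variable F : finFieldType.
Hypothesis addFF : forall z : F, (z + z = 0)%R.
Local Open Scope ring_scope.
Implicit Types (B G S : {set F}) (x y : F).

(** The range of [l] in the recursive condition is empty here. *)
Lemma mem_W_small k B : (k <= 4)%N ->
  B \in W F k <-> [/\ B \subset points F, #|B| = k & sumset B = 1].
Proof.
move=> k4; rewrite in_W; split=> [[]|[sB cB s1]]; split=> // l l2 lk; lia.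
Qed.

Lemma pair_W2 x y : x \in points F -> y \in points F -> x != y ->
  x + y = 1 -> [set x; y] \in W F 2.
Proof.
move=> xP yP nxy s1; apply/mem_W_small => //; split.
- by rewrite subUset !sub1set xP yP.
- by rewrite cards2 nxy.
- by rewrite sumsetU1 ?inE // sumset1.
Qed.

Lemma points_addr1 x : x \in points F -> 1 + x \in points F.
Proof.
rewrite !inE => /andP[x0 x1]; apply/andP; split; apply/eqP.
  by move/(addVV_eq0 addFF)/esym/eqP; rewrite (negPf x1).
by move/eqP; rewrite -subr_eq0 addrAC subrr add0r (negPf x0).
Qed.

Lemma neq_addr1 x : x != 1 + x.
Proof.
apply/eqP=> /eqP; rewrite -subr_eq0 opprD addrCA subrr addr0 oppr_eq0.
by rewrite oner_eq0.
Qed.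

(** Groups are thus cosets of the subgroup formed by 0 and 1, which is why they partition the
    points. *)
Lemma W2_group G x : G \in W F 2 -> x \in G -> G = [set x; 1 + x].
Proof.
move=> /mem_W_small [] // _ cG s1 xG.
have /cards1P[y yE] : #|G :\ x| == 1%N.
  by move: cG; rewrite (cardsD1 x) xG add1n => -[->].
move: s1; rewrite (sumsetD1 xG) yE sumset1 => xy.
by rewrite -xy addrAC addFF add0r -yE setD1K.
Qed.

Lemma W2_partition : partition (W F 2) (points F).
Proof.
apply/and3P; split.
- rewrite eqEsubset; apply/andP; split; apply/subsetP=> x.
    by case/bigcupP=> G /mem_W_small [] // /subsetP sG _ _ /sG.
  move=> xP; apply/bigcupP; exists [set x; 1 + x]; last by rewrite !inE eqxx.
  apply: pair_W2; rewrite ?points_addr1 ?neq_addr1 //.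
  by rewrite addrCA addFF addr0.
- apply/trivIsetP=> G H GW HW; apply: contraR => /pred0Pn[x /= /andP[xG xH]].
  by rewrite (W2_group GW xG) (W2_group HW xH).
- by apply/negP=> /mem_W_small [] // _; rewrite cards0.
Qed.

Lemma independent_triple x y : x \in points F -> y \in points F -> x != y ->
  x + y != 1 -> independent [set 1; x; y].
Proof.
rewrite !inE => /andP[x0 x1] /andP[y0 y1] nxy xy1.
have -> : [set 1; x; y] = y |: (x |: (1 |: set0)).
  by apply/setP=> z; rewrite !inE orbF orbC (orbC (z == 1)).
have add_neq0 (a b : F) : a != b -> a + b != 0.
  by apply: contra_neq => /(addVV_eq0 addFF).
rewrite !(independentU1 addFF) ?independent0 ?span2_set0 ?inE ?oner_eq0 ?orbF //=.
- apply/andP; split; apply/negP.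
    move/(span2_setU1 addFF); rewrite span2_set0 !inE (negPf x0) /=.
    by apply/negP/add_neq0; rewrite eq_sym.
  (* The span of 1 and [x] consists of 0, 1, [x] and [1 + x]; the hypotheses exclude each as a value
     of [y]. *)
  case/(span2_setU1 addFF)/orP => /(span2_setU1 addFF)/orP[];
    rewrite span2_set0 inE; apply/negP=> //; apply: add_neq0 => //.
  - by rewrite eq_sym.
  - by rewrite eq_sym.
by rewrite negb_or eq_sym nxy.
Qed.

Lemma mem_W6 B : B \in W F 6 <->
  [/\ 1 \notin B, #|B| = 6 & circuit (1 |: B)].
Proof.
split=> [/in_W [/subsetP sB cB s1 H]|[B1 cB /circuitP [s0 H]]].
  have B1 : 1 \notin B by apply/negP=> /sB; rewrite !inE eqxx andbF.
  split=> //; apply/circuitP; split.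
    by rewrite sumsetU1 // /sumset s1 addFF.
  have noW k S : (2 <= k <= 3)%N -> S \subset B -> #|S| = k -> sumset S <> 1.
    move=> /andP[k2 k3] sSB cS s1S.
    have SW : S \in W F k.
      apply/mem_W_small; first lia; split=> //.
      by apply: subset_trans sSB _; apply/subsetP.
    have /setP/(_ S) : ksubsets k B :&: W F k = set0 by apply: H; lia.
    by rewrite in_setI in_set0 SW inE sSB cS eqxx.
  (* The complement of [S] in [B] has sum 1. Sizes 1 and 2 of [S] fail directly; sizes 3 and 4 put
     the complement in [W F 3] or [W F 2]; size 5 makes it the singleton of 1, and size 6 gives
     [0 = 1]. *)
  have key S : S \subset B -> sumset S = 0 -> S = set0.
    move=> sSB s0; have := sumset_setD sSB; rewrite s0 add0r {1}/sumset s1.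
    move/esym => sD.
    have cD : #|B :\: S| = (6 - #|S|)%N by rewrite cardsD (setIidPr sSB) cB.
    have le6 : (#|S| <= 6)%N by rewrite -cB subset_leq_card.
    have sDB := subsetDl B S.
    move cSE: #|S| cD le6 => [|[|[|[|[|[|[|c]]]]]]] //= cD _.
    - exact: cards0_eq.
    - move/eqP/cards1P: cSE => [x SE]; move: s0; rewrite SE sumset1 => x0.
      have /sB : x \in B by rewrite -sub1set -SE.
      by rewrite inE x0 eqxx.
    - move/eqP/cards2P: cSE => [x [y [nxy SE]]].
      move: s0; rewrite SE sumsetU1 ?inE // sumset1 => /(addVV_eq0 addFF) xy.
      by rewrite xy eqxx in nxy.
    - by case: (noW 3%N _ isT sDB cD).
    - by case: (noW 2%N _ isT sDB cD).
    - move/eqP/cards1P: cD => [x DE]; move: sD; rewrite DE sumset1 => x1.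
      have /sB : x \in B by rewrite -sub1set -DE.
      by rewrite x1 inE eqxx andbF.
    - move: sD; rewrite (cards0_eq cD) sumset0 => /esym/eqP.
      by rewrite oner_eq0.
  move=> S pS s0; have sS := proper_sub pS.
  have [S1|S1] := boolP (1 \in S); last first.
    apply: key => //; apply/subsetP=> x xS.
    move/subsetP/(_ x xS): sS; rewrite !inE => /orP[/eqP x1|//].
    by rewrite -x1 xS in S1.
  (* Here [S :\ 1] has sum 1, so [B :\: S] has sum 0 and is empty by [key]; then [S] is all of
     [1 |: B]. *)
  have sDS : S :\ 1 \subset B by rewrite subDset.
  have sD1 : sumset (S :\ 1) = 1.
    by apply/esym/(addVV_eq0 addFF); rewrite -sumsetD1.
  have D0 : B :\: S = set0.
    apply: key; first exact: subsetDl.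
    have := sumset_setD sDS; rewrite {1}/sumset s1 sD1 -{1}[1]addr0 => /addrI ->.
    congr sumset; apply/setP=> x; rewrite !inE.
    by have [->|] := eqVneq x 1; rewrite ?(negPf B1) ?andbF.
  case/andP: pS => _ /negP[]; rewrite subUset sub1set S1 /=.
  by rewrite -setD_eq0 D0.
have nB : B \proper 1 |: B by rewrite properE subsetUr subUset sub1set (negPf B1).
have s1 : sumset B = 1 by apply/esym/(addVV_eq0 addFF); rewrite -sumsetU1.
apply/in_W; split=> //.
  apply/subsetP=> x xB; rewrite !inE; apply/andP; split.
    have px : [set x] \proper 1 |: B.
      by apply: sub_proper_trans nB; rewrite sub1set.
    apply/eqP=> x0; have := H _ px; rewrite sumset1 => /(_ x0).
    by move/setP/(_ x); rewrite !inE eqxx.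
  by apply: contraNneq B1 => <-.
move=> l l2 l6; apply/setP=> S; rewrite in_setI in_set0 [S \in _]inE.
apply/negP=> /andP[/andP[sS /eqP cS]] /mem_W_small[]; first lia.
move=> _ _ sS1.
(* Adjoining 1 to [S] gives a nonempty zero-sum set, proper in the circuit because [l <= 3]. *)
have S1 : 1 \notin S by apply: contra B1; apply/subsetP.
have := H (1 |: S); rewrite sumsetU1 // sS1 addFF.
have -> : 1 |: S \proper 1 |: B.
  by rewrite properEcard setUS // !cardsU1 S1 B1 cS cB; lia.
by move=> /(_ isT erefl) /setP/(_ 1); rewrite !inE eqxx.
Qed.

(** Adjoining 1 is a bijection from these blocks to the 7-circuits through 1, [x], [y]; 24 is
    [(7 - 3)!] and the factors come from [j = 3, 4, 5]. *)
Lemma card_W6_through x y : x \in points F -> y \in points F -> x != y ->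
  x + y != 1 ->
  (#|[set B in W F 6 | (x \in B) && (y \in B)]| * 24 =
   (#|F| - 8) * (#|F| - 16) * (#|F| - 32))%N.
Proof.
move=> xP yP nxy xy1; have iA := independent_triple xP yP nxy xy1.
have cA : #|[set 1; x; y]| = 3.
  move: xP yP; rewrite !inE => /andP[_ x1] /andP[_ y1].
  by rewrite setUC cardsU1 cards2 !inE negb_or y1 (eq_sym y) nxy (eq_sym 1) x1.
have := card_circuits_over addFF (n := 7) iA; rewrite cA => /(_ isT).
rewrite 3?big_nat_recl // big_geq // muln1 mulnA => <-.
congr (_ * _)%N; rewrite -(card_in_imset (f := fun B => 1 |: B)); last first.
  move=> B C; rewrite inE => /andP[/mem_W6 [B1 _ _] _].
  rewrite inE => /andP[/mem_W6 [C1 _ _] _].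
  by move=> e; rewrite -(setU1K B1) e setU1K.
apply: eq_card => C; apply/imsetP/idP => [[B]|].
  rewrite inE => /andP[/mem_W6 [B1 cB ciB] /andP[xB yB]] ->.
  rewrite inE ciB cardsU1 B1 cB /= !subUset !sub1set !inE eqxx xB yB.
  by rewrite !orbT.
rewrite inE !subUset !sub1set => /and3P[ciC /eqP cC /andP[/andP[C1 xC] yC]].
exists (C :\ 1); last by rewrite setD1K.
have neq1 z : z \in points F -> z != 1 by rewrite inE => /andP[].
rewrite inE !in_setD1 !neq1 // xC yC !andbT.
apply/mem_W6; rewrite setD1K // !inE eqxx; split=> //.
by move: cC; rewrite (cardsD1 1) C1 => -[].
Qed.

End Design.

(** * Integrality of the balance parameter and the design axioms *)

Theorem theorem3p17 (m : nat) (F : finFieldType)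
    (hm : 6 <= m) (hF : #|F| = 2 ^ m) :
  exists2 lambda6 : nat,
    (lambda6%:R =
      ((2 ^+ m - 8) * (2 ^+ m - 16) * (2 ^+ m - 32)) / (4`!)%:R :> rat)%R
    & is_GDD (2 ^ m - 2) 2 6 lambda6 (points F) (W F 2) (W F 6).
Proof.
have addFF (z : F) : (z + z = 0)%R.
  have /andP[p2 /eqP two0] : 2 \in [pchar F]%R.
    by apply: (card_finPcharP (n := m)) hF _.
  by rewrite -mulr2n -mulr_natl two0 mul0r.
have [t qE t3] : exists2 t, 2 ^ m = 64 * t & t %% 3 != 0 /\ 0 < t.
  exists (2 ^ (m - 6)); first by rewrite -(expnD 2 6) subnKC.
  split; last by rewrite expn_gt0.
  by rewrite -/(dvdn _ _) Euclid_dvdX.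
pose N := (2 ^ m - 8) * (2 ^ m - 16) * (2 ^ m - 32).
(* A single factor is already divisible by 24: [64 * t - 16] if [t] is 1 modulo 3, and [64 * t - 8]
   if [t] is 2 modulo 3. *)
have dvdN : N = N %/ 24 * 24.
  apply/esym/divnK; have [t1|t2] : t %% 3 = 1 \/ t %% 3 = 2 by lia.
    apply/dvdn_mulr/dvdn_mull/dvdnP; exists (8 * (t %/ 3) + 2); lia.
  by apply/dvdn_mulr/dvdn_mulr/dvdnP; exists (8 * (t %/ 3) + 5); lia.
exists (N %/ 24).
  apply/esym/(canLR (mulfK _)); first by rewrite Num.Theory.pnatr_eq0.
  rewrite -natrM -dvdN /N !natrM !natrB ?natrX //; lia.
have cX : #|points F| = 2 ^ m - 2.
  have XC : ~: points F = [set 0; 1]%R.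
    by apply/setP=> x; rewrite !inE negb_and !negbK.
  by rewrite -hF -(cardsC (points F)) XC cards2 eq_sym oner_eq0 addnK.
split=> //.
- by move=> G /mem_W_small [].
- by move=> B /in_W [].
- by move=> B /in_W [].
- exact: W2_partition.
- move=> B G x y BW GW xB yB nxy [xG yG].
  (* The case [l = 2] of the recursive condition says that no group lies inside a block. *)
  have [_ _ _ /(_ 2 isT isT)] := (in_W _ _).1 BW.
  move/setP/(_ G); rewrite in_setI in_set0 GW andbT inE.
  have [_ cG _] := (mem_W_small G (isT : 2 <= 4)).1 GW.
  rewrite cG eqxx andbT => /negP[].
  have -> : G = [set x; y].
    by apply/esym/eqP; rewrite eqEcard subUset !sub1set xG yG cards2 nxy cG.
  by rewrite subUset !sub1set xB yB.
move=> x y xX yX nxy hG.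
(* Two distinct points with sum 1 would themselves form a group. *)
have xy1 : (x + y != 1)%R.
  apply/eqP=> xy1; apply: (hG [set x; y]); first exact: pair_W2.
  by rewrite !inE !eqxx orbT.
apply/eqP; rewrite -(eqn_pmul2r (m := 24)) // -dvdN /N -hF.
exact/eqP/card_W6_through.
Qed.
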